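(* Assume that $f_1,\ldots,f_r$ have simple and distinct zeros, i.e. every zero of each $f_j$ is simple and no complex number is a zero of both $f_i$ and $f_j$ for $i\ne j$. Then, for any $s_0\in\mathbb C\setminus\{1\}$, the following are equivalent: (1) Artin's conjecture is true at $s_0$, i.e. $\mathbb F[H(s_0)]=\mathbb F[x_1,\ldots,x_r]$. (2) There exists $1\le t\le r-1$ such that $L_t\ge N_t$. (3) $\prod_{j\ne i}x_j\in\mathbb F[H(s_0)]$ for all $1\le i\le r$. (4) For every $j,k\in\{1,\ldots,r\}$ with $j\ne k$ there exists a monomial $u\in\mathbb F[H(s_0)]$ such that $x_j\mid u$ and $x_k\nmid u$. (5) There exists $1\le m<r$ such that for every set $M\subset\{1,\ldots,r\}$ with $m$ elements and for every $j\in M$ there exists an integer $k_j>0$ such that $\prod_{j\in M}x_j^{k_j}\in\mathbb F[H(s_0)]$ (i.e., for each such $M$ there are positive integers $(k_j)_{j\in M}$ with $\prod_{j\in M}x_j^{k_j}\in\mathbb F[H(s_0)]$).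
   Context: Let $K/\mathbb Q$ be a finite Galois extension with Galois group $G$, let $\chi_1,\ldots,\chi_r$ be the irreducible complex characters of $G$, and let $f_j(s)=L(s,\chi_j,K/\mathbb Q)$, $1\le j\le r$, be their Artin L-functions (meromorphic on $\mathbb C$). For $s_0\in\mathbb C\setminus\{1\}$ let $\ell_j:=\operatorname{ord}_{s=s_0}f_j\in\mathbb Z$ be the order of $s_0$ as a zero of $f_j$ (negative if $f_j$ has a pole at $s_0$). Artin's conjecture at $s_0$ is the statement that $f_1,\ldots,f_r$ are all holomorphic at $s_0$. Let $\mathbb F$ be a field with $\mathbb C\subseteq\mathbb F\subseteq\mathcal M_{<1}$, where $\mathcal M_{<1}$ is the field of meromorphic functions on $\mathbb C$ of order $<1$. Let $H(s_0)$ be the set of $(a_1,\ldots,a_r)\in\mathbb N^r$ (with $0\in\mathbb N$) such that $L(s,a_1\chi_1+\cdots+a_r\chi_r)=f_1^{a_1}\cdots f_r^{a_r}$ is holomorphic at $s_0$, i.e. $H(s_0)=\{a\in\mathbb N^r: a_1\ell_1+\cdots+a_r\ell_r\ge 0\}$. Let $\mathbb F[H(s_0)]\subseteq\mathbb F[x_1,\ldots,x_r]$ be the $\mathbb F$-subalgebra spanned by the monomials $x_1^{a_1}\cdots x_r^{a_r}$ with $(a_1,\ldots,a_r)\in H(s_0)$. The support of a monomial $v$ is $\operatorname{supp}(v):=\{x_j: x_j\mid v\}$. For any $1\le t\le r-1$, $$N_t:=\min\left\{\binom{r-1}{t-1}+\binom{r-2}{t}+1,\ \binom{r}{t}\right\},$$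 $$L_t:=\left|\{\operatorname{supp}(v): v\in\mathbb F[H(s_0)]\text{ a monomial},\ |\operatorname{supp}(v)|=t\}\right|,$$ where $\binom{n}{k}=0$ if $k>n$. *)

(* Defs.v *)
(* The complex field is R[i] for R : realType. *)
From mathcomp Require Export all_boot all_order all_algebra all_fingroup.
From mathcomp Require Export all_field all_character.
From mathcomp Require Export all_classical all_reals all_analysis.
From mathcomp Require Export complex.
(* The notations of mpoly clash with those of mathcomp-analysis. *)
From mathcomp Require Export -(notations) mpoly.

Set Implicit Arguments.
Unset Strict Implicit.
Unset Printing Implicit Defensive.

Import Order.TTheory GRing.Theory Num.Theory.
Import numFieldNormedType.Exports.

Local Open Scope classical_set_scope.
Local Open Scope complex_scope.
Local Open Scope ring_scope.

(** ** Meromorphic functions on the complex plane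

  A meromorphic function is represented by a total function C -> C whose values
  on a closed discrete set (poles, removable singularities) are irrelevant. The
  first definitions are over an arbitrary numFieldType, since this is the type
  on which the topology of a numeric field is found; they are used at R[i]. *)

Definition holomorphic_near (C : numFieldType) (g : C -> C) (z0 : C) : Prop :=
  \forall z \near z0, derivable (g : C^o -> C^o) z 1.

Definition has_order (C : numFieldType) (f : C -> C) (z0 : C) (m : int) : Prop :=
  exists g : C -> C, [/\ holomorphic_near g z0, g z0 != 0
    & \forall z \near z0^', f z = (z - z0) ^ m * g z].

(* The junk value 0 is taken only if f is not meromorphic at z0 or vanishes
   identically around z0. *)
Definition mero_ord (C : numFieldType) (f : C -> C) (z0 : C) : int :=
  xget 0 [set m | has_order f z0 m].

Definition meromorphic (C : numFieldType) (f : C -> C) : Prop :=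
  forall z0 : C,
    (\forall z \near z0^', f z = 0) \/ (exists m : int, has_order f z0 m).

(* Equality of meromorphic functions. *)
Definition mero_eq (C : numFieldType) (f g : C -> C) : Prop :=
  forall z0 : C, \forall z \near z0^', f z = g z.

(* For a meromorphic function: z0 is not a pole. *)
Definition holomorphic_at (C : numFieldType) (f : C -> C) (z0 : C) : Prop :=
  exists2 g : C -> C, holomorphic_near g z0 & \forall z \near z0^', f z = g z.

Definition converges_to (C : numFieldType) (u : nat -> C) (l : C) : Prop :=
  u @ \oo --> l.

(** ** Growth order of a meromorphic function (Nevanlinna) *)

Definition cmod (R : realType) (z : R[i]) : R := complex.Re `|z|.

Definition circle_pt (R : realType) (r t : R) : R[i] :=
  Complex (r * cos t) (r * sin t).

Definition proximity (R : realType) (f : R[i] -> R[i]) (r : R) : R :=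
  (2 * pi)^-1 * \int[@lebesgue_measure R]_(t in `[0, 2 * pi])
                   Num.max 0 (ln (cmod (f (circle_pt r t)))).

Definition pole_counting (R : realType) (f : R[i] -> R[i]) (r : R) : R :=
  \sum_(b \in [set b : R[i] | [/\ 0 < cmod b, cmod b < r & mero_ord f b < 0]])
     ((- mero_ord f b)%:~R * ln (r / cmod b))
  + (Num.max 0 (- mero_ord f 0))%:~R * ln r.

Definition nevanlinna_T (R : realType) (f : R[i] -> R[i]) (r : R) : R :=
  proximity f r + pole_counting f r.

Definition growth_order (R : realType) (f : R[i] -> R[i]) : \bar R :=
  limf_esup (fun r : R => (ln (nevanlinna_T f r) / ln r)%:E) (pinfty_nbhs R).

(* The map ev realizes the field F as a field of meromorphic functions of order
   < 1 that contains the constants. Injectivity of ev up to mero_eq is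
   automatic: F is a field and ev does not kill 1. *)
Record field_between_C_and_Mlt1 (R : realType) (F : fieldType)
    (ev : F -> R[i] -> R[i]) : Prop := {
  ev_mero : forall x, meromorphic (ev x);
  ev_order : forall x, (growth_order (ev x) < 1)%E;
  ev_add : forall x y, mero_eq (ev (x + y)) (fun z => ev x z + ev y z);
  ev_mul : forall x y, mero_eq (ev (x * y)) (fun z => ev x z * ev y z);
  ev_one : mero_eq (ev 1) (fun=> 1);
  ev_const : forall c : R[i], exists x, mero_eq (ev x) (fun=> c)
}.

(** ** Artin L-functions over the rationals *)

Definition alg_integer (K : splittingFieldType rat) (x : K) : Prop :=
  integralOver (intr : int -> K) x.

(* P is a prime ideal of the ring of integers of K lying over p. *)
Definition prime_ideal_over (K : splittingFieldType rat) (p : nat)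
    (P : set K) : Prop :=
  [/\ (forall x, P x -> alg_integer x),
      P p%:R /\ ~ P 1,
      (forall x y, P x -> P y -> P (x + y)),
      (forall a x, alg_integer a -> P x -> P (a * x))
    & (forall x y, alg_integer x -> alg_integer y -> P (x * y) -> P x \/ P y)].

Definition inertia (K : splittingFieldType rat) (P : set K) :
    {set gal_of {:K}} :=
  [set s in 'Gal({:K} / 1)%g | `[< forall x, alg_integer x -> P (s x - x) >]].

Definition is_frobenius (K : splittingFieldType rat) (p : nat) (P : set K)
    (s : gal_of {:K}) : Prop :=
  forall x, alg_integer x -> P (s x - x ^+ p).

(* The polynomial det(1 - X Frob_P | V^{I_P}), where P is a chosen prime over p
   and Frob_P a chosen Frobenius element; the result does not depend on these
   choices. In a representation matrices act on row vectors and in gal_of the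
   product s * t is "s, then t", so rG is an ordinary linear representation of
   the Galois group for the usual composition of automorphisms. *)
Definition artin_local_poly (K : splittingFieldType rat) (n : nat)
    (rG : mx_representation algC 'Gal({:K} / 1)%g n) (p : nat) : {poly algC} :=
  let P := xget set0 [set P : set K | prime_ideal_over p P] in
  let s := odflt 1%g [pick s in 'Gal({:K} / 1)%g | `[< is_frobenius p P s >]] in
  let A := restrictmx (rfix_mx rG (inertia P)) (rG s) in
  \det (1%:M - 'X *: map_mx polyC A).

Definition cexp (R : realType) (z : R[i]) : R[i] :=
  Complex (expR (complex.Re z) * cos (complex.Im z))
          (expR (complex.Re z) * sin (complex.Im z)).

Definition nat_cpow (R : realType) (n : nat) (s : R[i]) : R[i] :=
  cexp (s * Complex (ln n%:R) 0).

Definition artin_euler_product (R : realType) (iota : {rmorphism algC -> R[i]})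
    (K : splittingFieldType rat) (n : nat)
    (rG : mx_representation algC 'Gal({:K} / 1)%g n) (s : R[i]) (N : nat) : R[i] :=
  \prod_(p < N | prime p)
     ((map_poly iota (artin_local_poly rG p)).[nat_cpow p (- s)])^-1.

(* f is the Artin L-function of rG, i.e. the meromorphic continuation to C of
   the Euler product. Characters have values in algC; iota is an embedding of
   algC into C. *)
Definition is_artin_L (R : realType) (iota : {rmorphism algC -> R[i]})
    (K : splittingFieldType rat) (n : nat)
    (rG : mx_representation algC 'Gal({:K} / 1)%g n) (f : R[i] -> R[i]) : Prop :=
  meromorphic f /\
  forall s : R[i], 1 < complex.Re s ->
    converges_to (artin_euler_product iota rG s) (f s).

(** ** The semigroup H(s_0) and its algebra *)

Definition holo_semigroup (R : realType) (r : nat) (f : 'I_r -> R[i] -> R[i])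
    (s0 : R[i]) : set (multinom r) :=
  [set a | 0 <= \sum_(j < r) mero_ord (f j) s0 *+ a j].

Definition mvar (F : fieldType) (r : nat) (j : 'I_r) : mpoly r F :=
  mpolyX F (mnm1 j).

Definition semigroup_algebra (F : fieldType) (r : nat) (H : set (multinom r)) :
    set (mpoly r F) :=
  [set q | exists2 s : seq (F * multinom r),
     (forall ca, ca \in s -> H ca.2)
     & q = \sum_(ca <- s) ca.1 *: mpolyX F ca.2].

Definition ring_dvd (A : comNzRingType) (a b : A) : Prop :=
  exists c : A, b = a * c.

Definition supp (F : fieldType) (r : nat) (v : mpoly r F) : {set 'I_r} :=
  [set j | `[< ring_dvd (mvar F j) v >]].

Definition N_ (r t : nat) : nat :=
  minn ('C(r - 1, t - 1) + 'C(r - 2, t) + 1)%N 'C(r, t).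

Definition L_ (F : fieldType) (r : nat) (H : set (multinom r)) (t : nat) : nat :=
  #|[set S : {set 'I_r} | `[< exists a : multinom r,
       [/\ semigroup_algebra H (mpolyX F a), supp (mpolyX F a) = S
         & #|supp (mpolyX F a)| = t] >]]%SET|.

(* Main.v *)
Require Import Defs.
From mathcomp Require Import zify.

Set Implicit Arguments.
Unset Strict Implicit.
Unset Printing Implicit Defensive.

Import Order.TTheory GRing.Theory Num.Theory.
Import numFieldNormedType.Exports.
Local Open Scope classical_set_scope.
Local Open Scope complex_scope.
Local Open Scope ring_scope.

(** Write l_j for the order of f_j at s0. Each of the conditions is equivalent to
    all the l_j being nonnegative.

    If they all are, then H(s0) is the set of all exponents and every condition
    is clear; L_t is then the binomial coefficient of r and t, one of the two
    numbers of which N_t is the minimum.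

    Conversely, let l_i < 0. As no two of the f_j have a common zero, at most
    one l_j is positive, so there is an index k != i such that l_j <= 0 for all
    j != k. A monomial of F[H(s0)] divisible by x_i must then be divisible by
    x_k, since otherwise the sum of the a_j l_j would be negative
    (negative_order_forces). This contradicts directly the conditions on
    products of variables and on separation of variables. As for the supports,
    no t-subset of the indices that contains i but not k is the support of a
    monomial of F[H(s0)]. There are C(r-2, t-1) such subsets, hence
    L_t <= C(r, t) - C(r-2, t-1) (forces_L_bound). By Pascal's rule, applied
    twice, N_t = C(r, t) - C(r-2, t-1) + 1 (N_E), so L_t < N_t.

    As the f_j are meromorphic, f_j is holomorphic at s0 if and only if l_j >= 0
    (holomorphic_at_mero_ord). *)

(** * Orders and holomorphy *)

Lemma holomorphic_near_cvg (C : numFieldType) (g : C -> C) (z0 : C) :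
  holomorphic_near g z0 -> g z @[z --> z0^'] --> g z0.
Proof.
move=> hg; apply: cvg_within_filter.
apply: (@differentiable_continuous C C^o C^o); apply/derivable1_diffP.
exact: nbhs_singleton hg.
Qed.

Lemma holomorphic_near_subXM (C : numFieldType) (g : C -> C) (z0 : C) (n : nat) :
  holomorphic_near g z0 -> holomorphic_near (fun z => (z - z0) ^+ n * g z) z0.
Proof.
move=> hg; near=> z.
pose u : C^o -> C := fun x => x - z0.
have du : derivable u z 1.
  by apply: derivableB; [exact: derivable_id | exact: derivable_cst].
have dg : derivable (g : C^o -> C^o) z 1 by near: z.
have := derivableM (derivableX (n := n) du) dg.
rewrite (_ : u ^+ n * g = (fun x => (x - z0) ^+ n * g x)) //.
by apply/funext => x; rewrite !fctE.
Unshelve. all: by end_near. Qed.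

(** If the order m were negative, then (z - z0) ^ - m times the holomorphic
    extension would tend to 0 at z0, while it agrees around z0 with a
    continuous function that does not vanish at z0. *)
Lemma has_order_holomorphic_ge0 (C : numFieldType) (f : C -> C) (z0 : C) (m : int) :
  has_order f z0 m -> holomorphic_at f z0 -> 0 <= m.
Proof.
move=> [g [hg g0 fg]] [h hh fh]; case: m fg => // n fg.
have gE : \forall z \near z0^', (z - z0) ^+ n.+1 * h z = g z.
  near=> z.
  have zz0 : (z - z0) ^+ n.+1 != 0.
    by rewrite expf_neq0 // subr_eq0; near: z; exact: nbhs_dnbhs_neq.
  have <- : f z = h z by near: z.
  have -> : f z = (z - z0) ^ Negz n * g z by near: z.
  by rewrite mulrA [X in X * _](mulfV zz0) mul1r.
have g_cvg0 : g z @[z --> z0^'] --> (0 : C).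
  have := holomorphic_near_cvg (holomorphic_near_subXM n.+1 hh).
  rewrite subrr expr0n mul0r; apply: cvg_trans.
  exact: near_eq_cvg gE.
have g00 := @cvg_unique C (@norm_hausdorff C C^o) _ _ _ _
  (holomorphic_near_cvg hg) g_cvg0.
by rewrite g00 eqxx in g0.
Unshelve. all: by end_near. Qed.

Lemma has_order_ge0_holomorphic (C : numFieldType) (f : C -> C) (z0 : C) (m : int) :
  has_order f z0 m -> 0 <= m -> holomorphic_at f z0.
Proof.
case: m => // n [g [hg g0 fg]] _.
by exists (fun z => (z - z0) ^+ n * g z) => //; exact: holomorphic_near_subXM.
Qed.

(** If f vanishes identically around z0, then it has no order there and mero_ord
    takes its default value 0; the equivalence also holds in this case. *)
Lemma holomorphic_at_mero_ord (C : numFieldType) (f : C -> C) (z0 : C) :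
  meromorphic f -> holomorphic_at f z0 <-> 0 <= mero_ord f z0.
Proof.
move=> mf; rewrite /mero_ord; case: xgetP => [m _ fm|fN].
  split; first exact: has_order_holomorphic_ge0.
  exact: has_order_ge0_holomorphic.
split=> // _; case: (mf z0) => [f0|[m fm]]; last by case: (fN m).
exists (fun=> 0) => //; near=> z; exact: derivable_cst.
Unshelve. all: by end_near. Qed.

(** * Monomials of a semigroup algebra *)

Lemma semigroup_algebraX (F : fieldType) (r : nat) (H : set (multinom r))
    (a : multinom r) : semigroup_algebra (F := F) H (mpolyX F a) <-> H a.
Proof.
split=> [[s sH aE]|Ha]; last first.
  exists [:: (1, a)]; first by move=> ca; rewrite inE => /eqP ->.
  by rewrite big_seq1 scale1r.
(* Compare the coefficients of the monomial a. *)
apply: contrapT => NHa; have /eqP := congr1 (mcoeff a) aE.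
rewrite mcoeffX eqxx raddf_sum big_seq big1 ?oner_eq0 // => ca /sH Hca.
rewrite /= mcoeffZ mcoeffX; case: eqP => [ca_a|]; last by rewrite mulr0.
by rewrite ca_a in Hca.
Qed.

Lemma semigroup_algebra_setT (F : fieldType) (r : nat) (H : set (multinom r)) :
  semigroup_algebra (F := F) H = setT <-> H = setT.
Proof.
split=> HT; apply/seteqP; split=> // q _.
  by apply/(semigroup_algebraX F); rewrite HT.
exists [seq (mcoeff m q, m) | m <- msupp q]; first by rewrite HT.
by rewrite big_map [LHS]mpolyE.
Qed.

Lemma ring_dvd_mvarX (F : fieldType) (r : nat) (a : multinom r) (j : 'I_r) :
  ring_dvd (mvar F j) (mpolyX F a) <-> a j != 0%N.
Proof.
split=> [[c aE]|aj]; last first.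
  exists (mpolyX F (mnm_sub a (mnm1 j))).
  by rewrite -mpolyXD addmC submK // lep1mP.
(* Evaluate at the point with j-th coordinate 0 and all others 1. *)
apply/negP => /eqP aj0; pose v (i : 'I_r) : F := (i != j)%:R.
have /eqP := congr1 (meval v) aE; rewrite mevalM mevalX mevalXU /v eqxx mul0r.
rewrite big1 ?oner_eq0 // => i _.
by have [->|] := eqVneq i j; rewrite ?aj0 ?expr0 ?expr1n.
Qed.

Lemma suppX (F : fieldType) (r : nat) (a : multinom r) :
  supp (mpolyX F a) = [set j | a j != 0%N]%SET.
Proof.
by apply/setP => j; rewrite !inE; apply/asboolP/idP => /ring_dvd_mvarX.
Qed.

(** The exponent equal to k on the indices satisfying P and to 0 elsewhere. *)
Definition mnm_on (r : nat) (P : pred 'I_r) (k : 'I_r -> nat) : multinom r :=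
  Multinom [tuple if P j then k j else 0%N | j < r].

Lemma mnm_onE (r : nat) (P : pred 'I_r) (k : 'I_r -> nat) (j : 'I_r) :
  mnm_on P k j = if P j then k j else 0%N.
Proof. exact: mnmE. Qed.

Lemma prod_mvarX (F : fieldType) (r : nat) (P : pred 'I_r) (k : 'I_r -> nat) :
  \prod_(j < r | P j) mvar F j ^+ k j = mpolyX F (mnm_on P k).
Proof.
rewrite mpolyXE_id big_mkcond; apply: eq_bigr => j _.
by rewrite mnm_onE; case: ifP.
Qed.

(** * The variable forced by a negative order *)

(** Every exponent in H that involves the variable i also involves k. *)
Definition forces (r : nat) (H : set (multinom r)) (i k : 'I_r) : Prop :=
  forall a, H a -> a i != 0%N -> a k != 0%N.

(** For k take the index with positive ell k if there is one, and otherwise any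
    index other than i; in the latter case no exponent in the set involves i. *)
Lemma negative_order_forces (r : nat) (ell : 'I_r -> int) (i : 'I_r) :
  (1 < r)%N ->
  (forall j k, j != k -> ~ (0 < ell j /\ 0 < ell k)) -> ell i < 0 ->
  exists2 k, k != i &
    forces [set a : multinom r | 0 <= \sum_(j < r) ell j *+ a j] i k.
Proof.
move=> r1 one_pos elli.
have [k ki ellk] : exists2 k, k != i & forall j, j != k -> ell j <= 0.
  have [/existsP [k ellk]|Npos] := boolP [exists k, 0 < ell k].
    exists k => [|j jk]; first by apply: contraTneq ellk => ->; rewrite ltNge ltW.
    by rewrite leNgt; apply/negP => ellj; exact: one_pos jk (conj ellj ellk).
  have : (0 < #|[set~ i]%SET|)%N by rewrite cardsC1 card_ord; lia.
  move=> /card_gt0P[k]; rewrite !inE => ki; exists k => // j _.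
  by rewrite leNgt; apply: contra Npos => ?; apply/existsP; exists j.
exists k => // a /= Ha ai; apply: contraTneq Ha => ak.
rewrite -ltNge (bigD1 i) //= ltr_wnDr //; last by rewrite pmulrn_llt0 ?lt0n.
apply: sumr_le0 => j _; have [->|jk] := eqVneq j k; first by rewrite ak mulr0n.
by rewrite mulrn_wle0 // ellk.
Qed.

Lemma card_setC2 (r : nat) (i k : 'I_r) :
  k != i -> #|(~: [set i; k])%SET| = (r - 2)%N.
Proof. by move=> ki; rewrite cardsCs finset.setCK card_ord cards2 eq_sym ki. Qed.

(** The t-subsets containing i but not k are not supports of monomials of the
    algebra, and there are C(r-2, t-1) of them. *)
Lemma forces_L_bound (F : fieldType) (r : nat) (H : set (multinom r)) (i k : 'I_r)
    (t : nat) : k != i -> forces H i k -> (0 < t)%N ->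
  (L_ F H t + 'C(r - 2, t - 1) <= 'C(r, t))%N.
Proof.
move=> ki Hik t0; set B := (~: [set i; k])%SET.
have cD := cards_draws B (t - 1)%N; rewrite card_setC2 // in cD; rewrite -cD.
have cT := card_draws 'I_r t; rewrite card_ord in cT; rewrite -cT.
set D := [set A : {set 'I_r} | _ & _]%SET.
have iD A : A \in D -> i \notin A.
  rewrite !inE => /andP[/fintype.subsetP AB _].
  by apply/negP => /AB; rewrite !inE eqxx.
have kD A : A \in D -> k \notin A.
  rewrite !inE => /andP[/fintype.subsetP AB _].
  by apply/negP => /AB; rewrite !inE eqxx orbT.
(* The t-subsets containing i but not k are the i |: A for A in D. *)
rewrite -(card_in_imset (f := fun A : {set 'I_r} => (i |: A)%SET) (D := mem D)); last first.
  by move=> A A' /iD iA /iD iA' /(congr1 (fun S => S :\ i)%SET); rewrite !setU1K.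
rewrite /L_; set LS := finset _; set E := imset _ _.
rewrite -cardsUI (_ : LS :&: E = finset.set0)%SET ?cards0 ?addn0.
  apply: subset_leq_card; apply/fintype.subsetP => S; rewrite !inE => /orP[].
    by move=> /asboolP[a [_ <- ->]].
  move=> /imsetP[A AD ->]; rewrite cardsU1 iD //.
  by move: AD; rewrite !inE => /andP[_ /eqP ->]; rewrite add1n subn1 prednK.
apply/setP => S; rewrite !inE; apply/negP => /andP[].
move=> /asboolP[a [/semigroup_algebraX Ha aS _]].
move=> /imsetP[A AD SE]; have /setP aA := etrans aS SE.
have := Hik a Ha; have := aA i; have := aA k.
rewrite suppX !inE eqxx (negPf ki) (negPf (kD _ AD)) /=.
by move=> -> -> /(_ isT).
Qed.

(** The second term of the minimum defining N_t is never the smaller one, since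
    C(r-2, t-1) > 0. *)
Lemma N_E (r t : nat) : (1 <= t <= r - 1)%N ->
  (N_ r t + 'C(r - 2, t - 1) = 'C(r, t).+1)%N.
Proof.
move=> /andP[]; case: t => // t _; rewrite /N_ subn1; case: r => // -[|r]; first by [].
rewrite !subSS !subn0 /= => tr.
have C0 : (0 < 'C(r, t))%N by rewrite bin_gt0.
rewrite !binS; lia.
Qed.

Lemma forces_L_lt_N (F : fieldType) (r : nat) (H : set (multinom r)) (i k : 'I_r)
    (t : nat) : k != i -> forces H i k -> (1 <= t <= r - 1)%N ->
  (L_ F H t < N_ r t)%N.
Proof.
move=> ki Hik tr; have /andP[t0 _] := tr.
have := forces_L_bound F ki Hik t0; have := N_E tr; lia.
Qed.

Lemma L_setT (F : fieldType) (r t : nat) : L_ F [set: multinom r] t = 'C(r, t).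
Proof.
rewrite /L_ -[in RHS](card_ord r) -card_draws; apply: eq_card => S; rewrite !inE.
apply/asboolP/eqP => [[a [_ <- ->]] //|St].
have aS : supp (mpolyX F (mnm_on (mem S) (fun=> 1%N))) = S.
  by rewrite suppX; apply/setP => j; rewrite inE mnm_onE; case: ifP.
exists (mnm_on (mem S) (fun=> 1%N)); split; rewrite ?aS //.
by apply/semigroup_algebraX.
Qed.

(** * The equivalence *)

Theorem corollary1p8 (R : realType) (iota : {rmorphism algC -> R[i]})
    (K : splittingFieldType rat)
    (f : Iirr 'Gal({:K} / 1)%g -> R[i] -> R[i])
    (F : fieldType) (ev : F -> R[i] -> R[i]) :
  let r := Nirr 'Gal({:K} / 1)%g in
  galois 1 {:K} ->
  (1 < r)%N ->
  (forall j : 'I_r, is_artin_L iota 'Chi_j (f j)) ->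
  field_between_C_and_Mlt1 ev ->
  (forall (j : 'I_r) (z : R[i]), 0 < mero_ord (f j) z -> mero_ord (f j) z = 1) ->
  (forall (i j : 'I_r) (z : R[i]), i != j ->
     ~ (0 < mero_ord (f i) z /\ 0 < mero_ord (f j) z)) ->
  forall s0 : R[i], s0 != 1 ->
  let FH := semigroup_algebra (F := F) (holo_semigroup f s0) in
  [<-> forall j : 'I_r, holomorphic_at (f j) s0;
       FH = setT;
       exists t : nat, (1 <= t <= r - 1)%N
         /\ (N_ r t <= L_ F (holo_semigroup f s0) t)%N;
       forall i : 'I_r, FH (\prod_(j < r | j != i) mvar F j);
       forall j k : 'I_r, j != k ->
         exists a : multinom r, [/\ FH (mpolyX F a),
           ring_dvd (mvar F j) (mpolyX F a)
           & ~ ring_dvd (mvar F k) (mpolyX F a)];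
       exists m : nat, (1 <= m < r)%N /\
         forall M : {set 'I_r}, #|M| = m ->
           exists k : 'I_r -> nat, (forall j, j \in M -> (0 < k j)%N)
             /\ FH (\prod_(j in M) mvar F j ^+ k j)].
Proof.
move=> r _ r1 Lf _ _ distinct s0 _ FH.
pose ell (j : 'I_r) := mero_ord (f j) s0.
have holoE j : holomorphic_at (f j) s0 <-> 0 <= ell j.
  by apply: holomorphic_at_mero_ord; case: (Lf j).
have allT : (forall j, 0 <= ell j) -> holo_semigroup f s0 = setT.
  move=> ell0; apply/seteqP; split=> // a _ /=.
  by apply: sumr_ge0 => j _; rewrite mulrn_wge0 ?ell0.
have forcesP : (forall i k, k != i -> ~ forces (holo_semigroup f s0) i k) ->
    forall j, 0 <= ell j.
  move=> NH j; rewrite leNgt; apply/negP => ellj.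
  have [|k kj] := negative_order_forces r1 _ ellj; last exact: NH.
  by move=> i k ik; exact: distinct.
have FHX a : FH (mpolyX F a) <-> holo_semigroup f s0 a.
  exact: semigroup_algebraX.
tfae.
- move=> fholo; apply/semigroup_algebra_setT; apply: allT => j; exact/holoE.
- move=> /semigroup_algebra_setT HT; exists 1%N; rewrite HT L_setT geq_minr; lia.
- move=> [t [tr LN]] i; have HT : holo_semigroup f s0 = setT.
    apply/allT/forcesP => i' k ki' /(forces_L_lt_N F ki') /(_ tr).
    by rewrite ltnNge LN.
  by rewrite /FH (semigroup_algebra_setT _ _).2.
- move=> FHi j k jk; have := FHi k.
  under eq_bigr do rewrite -[mvar _ _]expr1; rewrite prod_mvarX => Ha.
  eexists; split; first exact: Ha.
    by apply/ring_dvd_mvarX; rewrite mnm_onE jk.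
  by move=> /ring_dvd_mvarX; rewrite mnm_onE eqxx.
- move=> FHjk; have HT : holo_semigroup f s0 = setT.
    apply/allT/forcesP => i k ki Hik.
    have [|a [/FHX Ha /ring_dvd_mvarX ai]] := FHjk i k; first by rewrite eq_sym.
    by case; apply/ring_dvd_mvarX/Hik.
  exists 1%N; split=> // M _; exists (fun=> 1%N); split=> //.
  by rewrite /FH (semigroup_algebra_setT _ _).2.
- move=> [m [/andP[m0 mr] FHM]] j; apply/holoE; move: j; apply: forcesP => i k ki Hik.
  (* A set M = i |: A with m elements, containing i but not k. *)
  have [A AB cA] : exists2 A : {set 'I_r}, (A \subset ~: [set i; k])%SET & #|A| = m.-1.
    have := cards_draws (~: [set i; k])%SET m.-1.
    rewrite card_setC2 // => /esym cD.
    have : (0 < 'C(r - 2, m.-1))%N by rewrite bin_gt0; lia.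
    rewrite cD => /card_gt0P[A]; rewrite inE => /andP[AB /eqP cA]; by exists A.
  have iA : i \notin A.
    by apply/negP => /(fintype.subsetP AB); rewrite !inE eqxx.
  have kA : k \notin A.
    by apply/negP => /(fintype.subsetP AB); rewrite !inE eqxx orbT.
  have [|e [e0]] := FHM (i |: A)%SET; first by rewrite cardsU1 iA cA add1n prednK.
  rewrite prod_mvarX => /FHX /Hik; rewrite !mnm_onE !inE eqxx (negPf ki) (negPf kA) /=.
  by rewrite -lt0n e0 ?setU11 // => /(_ isT).
Qed.
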